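(* 1. For every graph $F$, $W_{\mathrm{tw}}(F)\ge v(F_0)$, where $F_0$ is the core of $F$. 2. For every connected graph $F$, $W_{\mathrm{tw}}(F)\ge \mathrm{tw}(F)+1$, except in the case that $F$ is a subtree of some megastar $M_{3,b}$.
   Context: Graphs are finite simple graphs; $v(F)$ is the number of vertices and $\mathrm{tw}(F)$ the treewidth. We use first-order logic of graphs with relation symbols for adjacency and equality only; the variable width of a sentence is the number of distinct variables it uses. $W_{\mathrm{tw}}(F)$ is the minimum variable width of a first-order sentence $\Phi$ for which there is an integer $k$ such that for every connected graph $G$ with $\mathrm{tw}(G)\ge k$, $G\models\Phi$ if and only if $G$ contains a (not necessarily induced) subgraph isomorphic to $F$. The core $F_0$ of $F$ is the graph obtained from $F$ by removing, consecutively and as long as possible, vertices of degree at most 1 (it is empty if $F$ is a forest). The megastar $M_{s,t}$ is obtained from the star $K_{1,s}$ by subdividing each edge into a path with $t+1$ vertices (so $v(M_{s,t})=st+1$). *)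

(* Defs.v *)
From mathcomp Require Import all_boot.
From mathcomp Require Import boolp.

Set Implicit Arguments.
Unset Strict Implicit.
Unset Printing Implicit Defensive.

Record sgraph := SGraph {
  vert :> finType;
  adj : rel vert;
  adj_sym : symmetric adj;
  adj_irr : irreflexive adj }.
Arguments adj {s}.

Definition nverts (G : sgraph) := #|G|.

Definition connected (G : sgraph) : Prop :=
  (0 < #|G|) /\ forall x y : G, connect (@adj G) x y.

Definition acyclic (G : sgraph) : Prop :=
  ~ exists c : seq G, [/\ 2 < size c, uniq c & cycle (@adj G) c].

Definition is_tree (G : sgraph) : Prop := connected G /\ acyclic G.

Definition contains (G F : sgraph) : Prop :=
  exists f : F -> G, injective f /\ forall x y : F, adj x y -> adj (f x) (f y).

Record tdec (G : sgraph) := TDec {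
  td_tree : sgraph;
  td_bag : td_tree -> {set G};
  td_is_tree : is_tree td_tree;
  td_cover : forall v : G, exists i, v \in td_bag i;
  td_edge : forall x y : G, adj x y -> exists i, (x \in td_bag i) && (y \in td_bag i);
  td_conn : forall (v : G) (i j : td_tree), v \in td_bag i -> v \in td_bag j ->
      connect [rel a b | [&& adj a b, v \in td_bag a & v \in td_bag b]] i j }.

Definition tw_le (G : sgraph) (k : nat) : Prop :=
  exists D : tdec G, forall i, #|@td_bag G D i| <= k.+1.

Definition unit_graph : sgraph.
Proof.
refine (@SGraph unit [rel _ _ | false] _ _); by [].
Defined.

Lemma unit_graph_tree : is_tree unit_graph.
Proof.
split.
  split; first by rewrite card_unit.
  by move=> [] []; exact: connect0.
move=> [c [Hs Hu _]].
have := uniq_leq_size (s1 := c) (s2 := enum unit_graph) Hu.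
move=> H; have : size c <= size (enum unit_graph).
  apply: H => x _; by rewrite mem_enum.
rewrite -cardE /= card_unit => Hc.
by move: (leq_trans Hs Hc).
Qed.


Definition tw_le_card_ex (G : sgraph) : exists k, `[< tw_le G k >].
Proof.
exists #|G|; apply/asboolP.
have D : tdec G.
  apply: (@TDec G unit_graph (fun _ => setT)).
  - exact: unit_graph_tree.
  - by move=> v; exists tt; rewrite inE.
  - by move=> x y _; exists tt; rewrite !inE.
  - by move=> v [] [] _ _; exact: connect0.
exists D => i; apply: leq_trans (max_card _) _; exact: leqnSn.
Qed.

Definition treewidth (G : sgraph) : nat := ex_minn (tw_le_card_ex G).

Definition deg_in (G : sgraph) (S : {set G}) (x : G) : nat :=
  #|[set y in S | adj x y]|.

Definition peel_step (G : sgraph) : rel {set G} :=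
  fun S S' => [exists x in S, (deg_in S x <= 1) && (S' == S :\ x)].

Definition is_core (G : sgraph) (S : {set G}) : Prop :=
  connect (@peel_step G) setT S /\ (forall x, x \in S -> 1 < deg_in S x).

Definition mstar_adj (s t : nat) : rel (option ('I_s * 'I_t)) :=
  fun u v => match u, v with
  | None, Some (_, j) => nat_of_ord j == 0
  | Some (_, j), None => nat_of_ord j == 0
  | Some (i, j), Some (i', j') =>
      (i == i') && ((j.+1 == j' :> nat) || (j'.+1 == j :> nat))
  | None, None => false
  end.

Lemma mstar_adj_sym (s t : nat) : symmetric (@mstar_adj s t).
Proof.
move=> [[i j]|] [[i' j']|] //=.
by rewrite eq_sym orbC.
Qed.

Lemma mstar_adj_irr (s t : nat) : irreflexive (@mstar_adj s t).
Proof.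
move=> [[i j]|] //=; rewrite eqxx /=.
by rewrite eq_sym (ltn_eqF (ltnSn j)).
Qed.

(* M_{s,t}: the star K_{1,s} with each edge subdivided into a path with
   t+1 vertices; vertex None is the centre, Some (i, j) is the (j+1)-th
   vertex of the i-th arm (j = 0 adjacent to the centre). *)
Definition megastar (s t : nat) : sgraph :=
  @SGraph (option ('I_s * 'I_t)) (@mstar_adj s t)
    (@mstar_adj_sym s t) (@mstar_adj_irr s t).

Definition subtree_of_M3 (F : sgraph) : Prop :=
  is_tree F /\ exists b, contains (megastar 3 b) F.

Inductive form :=
  | FEq  of nat & nat
  | FAdj of nat & nat
  | FNot of form
  | FAnd of form & form
  | FOr  of form & form
  | FEx  of nat & form
  | FAll of nat & form.

Fixpoint sat (G : sgraph) (a : nat -> G) (f : form) : Prop :=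
  match f with
  | FEq x y => a x = a y
  | FAdj x y => adj (a x) (a y)
  | FNot g => ~ sat a g
  | FAnd g h => sat a g /\ sat a h
  | FOr g h => sat a g \/ sat a h
  | FEx x g => exists v : G, sat (fun z => if z == x then v else a z) g
  | FAll x g => forall v : G, sat (fun z => if z == x then v else a z) g
  end.

Fixpoint free_vars (f : form) : seq nat :=
  match f with
  | FEq x y | FAdj x y => [:: x; y]
  | FNot g => free_vars g
  | FAnd g h | FOr g h => free_vars g ++ free_vars h
  | FEx x g | FAll x g => filter (fun z => z != x) (free_vars g)
  end.

Fixpoint all_vars (f : form) : seq nat :=
  match f with
  | FEq x y | FAdj x y => [:: x; y]
  | FNot g => all_vars g
  | FAnd g h | FOr g h => all_vars g ++ all_vars h
  | FEx x g | FAll x g => x :: all_vars g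
  end.

Definition sentence (f : form) : bool := nilp (free_vars f).

Definition var_width (f : form) : nat := size (undup (all_vars f)).

Definition models (G : sgraph) (f : form) : Prop := forall a : nat -> G, sat a f.

Definition tw_defines (F : sgraph) (Phi : form) : Prop :=
  sentence Phi /\
  exists k, forall G : sgraph, connected G -> k <= treewidth G ->
    (models G Phi <-> contains G F).

Definition Wtw_ge (F : sgraph) (m : nat) : Prop :=
  forall Phi, tw_defines F Phi -> m <= var_width Phi.

(* Main.v *)
Require Import Defs.
From mathcomp Require Import fingroup perm all_boot.
From mathcomp Require Import boolp zify.

(* 1. Let l be the size of the core and let A be a connected graph of large minimum
   degree (hence of large treewidth) whose girth exceeds v(F).  Glue a copy of A by
   its root to every vertex of K_l, respectively of K_(l-1).  The first graph
   contains F: place the core on the clique and attach the peeled vertices greedily.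
   The second does not: a cycle on at most v(F) vertices lives in the clique, hence
   so would the core.  With l-1 variables the two graphs are indistinguishable,
   since l-2 pebbles always leave a free clique vertex on both sides.
   2. If the core is nonempty, then tw(F) + 1 <= v(F_0) and 1. applies.  Otherwise F
   is a tree, tw(F) <= 1, and a sentence with one variable has the same value in all
   graphs; but K_n contains F, whereas a sufficiently subdivided cubic graph with a
   large clique minor contains no trees on v(F) vertices except subtrees of M_(3,b). *)

Set Implicit Arguments.
Unset Strict Implicit.
Unset Printing Implicit Defensive.

(** * Cycles, minimum degree and treewidth *)

Lemma cycle_of_min_degree (G : sgraph) (S : {set G}) (r y : G) :
    r \in S -> y \in S -> adj r y ->
    (forall x, x \in S -> x != r -> 1 < deg_in S x) ->
  exists c : seq G, [/\ 2 < size c, uniq c, {subset c <= S} & cycle adj c].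
Proof.
move=> rS yS ry Sdeg.
(* A path ending at [r] is grown at its front [e]. As [e] is not [r], it has a neighbour in [S]
   besides its successor: if that neighbour is new the path gets longer, otherwise it closes a
   cycle. Only the fixed end [r] may have a single neighbour in [S]; this is needed when [r] is the
   root of a glued copy. *)
have grow n : (exists c, [/\ 2 < size c, uniq c, {subset c <= S} & cycle adj c]) \/
    exists e q, [/\ size q = n.+1, path adj e q, uniq (e :: q),
                    {subset e :: q <= S} & last e q = r].
  elim: n => [|n [|[e [q [sz pq uq Sq lq]]]]]; [|by left|].
    right; exists y, [:: r]; split=> //=.
    - by rewrite adj_sym ry.
    - by rewrite inE andbT; apply/eqP=> yr; rewrite yr adj_irr in ry.
    - by move=> z; rewrite !inE => /orP[] /eqP ->.
  case: q => [|e1 q] // in sz pq uq Sq lq *.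
  have eS : e \in S by apply: Sq; rewrite inE eqxx.
  have er : e != r.
    by case/andP: uq => + _; apply: contra => /eqP ->; rewrite -lq /= mem_last.
  have := Sdeg _ eS er; rewrite /deg_in (cardsD1 e1) => dege.
  have /card_gt0P[z] : 0 < #|[set z in S | adj e z] :\ e1|.
    by move: dege; case: (_ \in _) => //=; rewrite ?add1n ?add0n // => /ltnW.
  rewrite !inE => /and3P[ze1 zS ez].
  have ze : z != e by apply/eqP=> zE; rewrite zE adj_irr in ez.
  case zq : (z \in e1 :: q); last first.
    right; exists z, [:: e, e1 & q]; split=> //=.
    - by rewrite -sz.
    - by rewrite adj_sym ez.
    - by rewrite inE negb_or ze zq.
    - by move=> t; rewrite inE => /predU1P[-> //|]; apply: Sq.
  left; rewrite inE (negPf ze1) /= in zq.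
  case/splitPr: zq pq uq Sq {sz lq} => q1 q2.
  rewrite -cat_rcons -cat_cons; set c1 := (e1 :: _).
  rewrite cat_path -cat_cons cat_uniq => /andP[pc _] /and3P[uc _ _] Sc.
  exists (e :: c1); split=> //.
  - by rewrite /= size_rcons.
  - by move=> t tc; apply: Sc; rewrite mem_cat tc.
  - by rewrite (cycle_path e) /= last_rcons adj_sym ez.
have [//|[e [q [sz _ uq _ _]]]] := grow #|G|.
have := max_card (mem (e :: q)); rewrite (card_uniqP uq) /= sz.
by rewrite ltnNge leqnSn.
Qed.

Lemma acyclic_leaf (G : sgraph) (S : {set G}) :
  acyclic G -> S != set0 -> exists2 x, x \in S & deg_in S x <= 1.
Proof.
move=> acG /set0Pn[r rS]; apply: contrapT => nleaf.
have Sdeg x : x \in S -> 1 < deg_in S x.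
  by move=> xS; rewrite ltnNge; apply/negP=> dx; apply: nleaf; exists x.
have /card_gt0P[y] := ltnW (Sdeg _ rS); rewrite inE => /andP[yS ry].
have [c [c3 uc _ cc]] := cycle_of_min_degree rS yS ry (fun x xS _ => Sdeg x xS).
by apply: acG; exists c.
Qed.

Lemma connect_ind (T : finType) (e : rel T) (P : T -> Prop) (x : T) :
  P x -> (forall y z, connect e x y -> P y -> e y z -> P z) ->
  forall y, connect e x y -> P y.
Proof.
move=> Px step y /connectP[p]; elim/last_ind: p y => [|p z IH] y /=.
  by move=> _ ->.
rewrite rcons_path last_rcons => /andP[pp ez] ->.
by apply: step ez; [apply/connectP; exists p | apply: IH pp _].
Qed.

(** Keep as few nodes of the decomposition tree as possible and look at a leaf among them. If every
    vertex of its bag occurred in a neighbouring bag, the leaf could be deleted. So some vertex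
    occurs in this bag only, and its closed neighbourhood has at most k+1 elements. *)
Lemma tw_min_degree (G : sgraph) (k : nat) :
  0 < #|G| -> tw_le G k -> exists x : G, #|adj x| <= k.
Proof.
case/card_gt0P=> g0 _ [D szD].
pose T := td_tree D; pose bag := @td_bag G D.
pose rest (U : {set T}) v := [rel a b : T |
  [&& adj a b, (a \in U) && (b \in U), v \in bag a & v \in bag b]].
(* [U] need not be connected in the tree: only the nodes carrying a common vertex have to be linked
   inside [U]. This suffices for deleting leaves. *)
pose good (U : {set T}) := [/\ forall v, exists2 i, i \in U & v \in bag i,
  forall x y, adj x y -> exists2 i, i \in U & (x \in bag i) && (y \in bag i) &
  forall v i j, i \in U -> j \in U -> v \in bag i -> v \in bag j ->
     connect (rest U v) i j].
have goodT : `[< good setT >].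
  apply/asboolP; split.
  - by move=> v; have [i vi] := td_cover D v; exists i.
  - by move=> x y /(td_edge D)[i xyi]; exists i.
  - move=> v i j _ _ vi vj; have := td_conn vi vj.
    by apply: connect_sub => a b /= abv; apply: connect1; rewrite /= !inE.
case: (@arg_minnP _ setT (fun U => `[< good U >]) (fun U => #|U|) goodT) => U /asboolP[cov edg con] Umin.
have U0' : U != set0.
  by apply/set0Pn; have [i iU _] := cov g0; exists i.
have [t tU dt] := acyclic_leaf (td_is_tree D).2 U0'.
(* a vertex lying in no bag next to the leaf t has its whole neighbourhood in the bag of t *)
have [[v vt nvt]|allv] := pselect (exists2 v, v \in bag t &
    forall p, p \in U -> adj t p -> v \notin bag p).
  have vonly i : i \in U -> v \in bag i -> i = t.
    move=> iU vi; have := con v t i tU iU vt vi; case/connectP=> [[|p q]] //=.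
    by case/andP=> /and4P[tp /andP[_ pU] _ vp]; rewrite (negPf (nvt _ pU tp)) in vp.
  exists v; rewrite -ltnS; apply: leq_trans (szD t).
  have -> : #|adj v| = #|[set y | adj v y]| by rewrite cardsE.
  rewrite -add1n -[1 + _](_ : #|v |: [set y | adj v y]| = _); last first.
    by rewrite cardsU1 inE adj_irr.
  apply/subset_leq_card/subsetP=> y; rewrite !inE => /predU1P[-> //|vy].
  by have [i iU /andP[vi yi]] := edg _ _ vy; rewrite -(vonly _ iU vi).
(* Now the bag of [t] is contained in the bag of its neighbour [p] in [U], which is unique because
   [t] is a leaf. For an empty bag the claim is vacuous and [t] serves as a dummy value. *)
have [p pt] : exists p, forall v, v \in bag t -> [/\ p \in U, adj t p & v \in bag p].
  have [bt|/set0Pn[v0 v0t]] := eqVneq (bag t) set0.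
    by exists t => v; rewrite bt inE.
  have nb v : v \in bag t -> exists2 p, (p \in U) && adj t p & v \in bag p.
    move=> vt; apply: contrapT => nv; apply: allv; exists v => // p pU tp.
    by apply/negP=> vp; apply: nv; exists p => //; rewrite pU.
  have [p /andP[pU tp] _] := nb _ v0t; exists p => v vt; split=> //.
  have [q qU vq] := nb _ vt; move/card_le1_eqP: dt => /(_ q p).
  by rewrite !inE => -> //; rewrite pU.
suff : #|U| <= #|U :\ t| by rewrite (cardsD1 t U) tU add1n ltnn.
apply: Umin; apply/asboolP; split.
- move=> v; have [i iU vi] := cov v; have [it|it] := eqVneq i t.
    rewrite it in vi; have [pU tp vp] := pt _ vi; exists p => //.
    by rewrite !inE pU andbT; apply/eqP=> pE; rewrite pE adj_irr in tp.
  by exists i; rewrite // !inE it.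
- move=> x y xy; have [i iU /andP[xi yi]] := edg _ _ xy; have [it|it] := eqVneq i t.
    rewrite it in xi yi; have [pU tp xp] := pt _ xi; have [_ _ yp] := pt _ yi.
    exists p; last by rewrite xp.
    by rewrite !inE pU andbT; apply/eqP=> pE; rewrite pE adj_irr in tp.
  by exists i; rewrite ?xi // !inE it.
- move=> v i j; rewrite !inE => /andP[it iU] /andP[jt jU] vi vj.
  (* Walks through the deleted leaf [t] are rerouted through [p]. *)
  pose phi a := if a == t then p else a.
  have step : forall a, connect (rest U v) i a -> connect (rest (U :\ t) v) i (phi a).
    apply: connect_ind => [|a b _]; first by rewrite /phi (negPf it) connect0.
    move=> ia /= /and4P[ab /andP[aU bU] va vb]; apply: connect_trans ia _.
    rewrite /phi; have [at_|at_] := eqVneq a t; have [bt|bt] := eqVneq b t.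
    + exact: connect0.
    + rewrite at_ in va ab; have [pU tp vp] := pt _ va.
      suff -> : p = b by exact: connect0.
      by move/card_le1_eqP: dt; apply; rewrite inE ?pU ?bU.
    + rewrite bt in vb ab; have [pU tp vp] := pt _ vb.
      suff -> : p = a by exact: connect0.
      by move/card_le1_eqP: dt; apply; rewrite inE ?pU ?aU // adj_sym.
    + by apply: connect1; rewrite /= !inE ab at_ bt aU bU va.
  by have := step j (con _ _ _ iU jU vi vj); rewrite /phi (negPf jt).
Qed.

Lemma treewidth_geP (G : sgraph) (k : nat) :
  (forall j, tw_le G j -> k <= j) -> k <= treewidth G.
Proof. by rewrite /treewidth; case: ex_minnP => m /asboolP mG _; apply. Qed.

Lemma treewidth_le (G : sgraph) (k : nat) : tw_le G k -> treewidth G <= k.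
Proof. by move=> Gk; rewrite /treewidth; case: ex_minnP => m _; apply; apply/asboolP. Qed.

Lemma treewidth_min_degree (G : sgraph) (k : nat) :
  0 < #|G| -> (forall x : G, k <= #|adj x|) -> k <= treewidth G.
Proof.
move=> G0 degG; apply: treewidth_geP => j /(tw_min_degree G0)[x].
exact: leq_trans.
Qed.

(** * Complete graphs and minors *)

Definition complete_graph (n : nat) : sgraph.
Proof.
refine (@SGraph 'I_n [rel x y | x != y] _ _).
- by move=> x y /=; rewrite eq_sym.
- by move=> x /=; rewrite eqxx.
Defined.

Lemma complete_graph_degree n (x : complete_graph n.+1) : #|adj x| = n.
Proof.
have := cardC1 x; rewrite card_ord /= => cx; apply: etrans cx.
by apply: eq_card => y; rewrite !inE /= eq_sym.
Qed.

Lemma complete_graph_treewidth n : n <= treewidth (complete_graph n.+1).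
Proof.
apply: treewidth_min_degree; first by rewrite card_ord.
by move=> x; rewrite complete_graph_degree.
Qed.

Lemma complete_graph_connected n : connected (complete_graph n.+1).
Proof.
split; first by rewrite card_ord.
by move=> x y; have [->|xy] := eqVneq x y; [apply: connect0 | apply: connect1].
Qed.

Lemma complete_graph_contains (F : sgraph) n :
  #|F| <= n -> contains (complete_graph n) F.
Proof.
move=> Fn; pose f x := widen_ord Fn (enum_rank x).
have f_inj : injective f by move=> x y /(congr1 val)/= /val_inj/enum_rank_inj.
exists f; split=> // x y xy /=; rewrite (inj_eq f_inj).
by apply/eqP=> xyE; rewrite xyE adj_irr in xy.
Qed.

(** The [B h] are the branch sets of a minor [H]. A decomposition of [G] becomes one of [H] on the
    same tree when each vertex of a bag is replaced by the branch set containing it. Connectivity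
    survives because adjacent vertices of a branch set share a bag. *)
Lemma treewidth_minor (G H : sgraph) (B : H -> {set G}) :
    (forall h, B h != set0) ->
    (forall h h' x, x \in B h -> x \in B h' -> h = h') ->
    (forall h x y, x \in B h -> y \in B h ->
       connect [rel a b | [&& adj a b, a \in B h & b \in B h]] x y) ->
    (forall h h', adj h h' -> exists x y, [/\ x \in B h, y \in B h' & adj x y]) ->
  treewidth H <= treewidth G.
Proof.
move=> B0 Bdisj Bconn Badj; apply: treewidth_geP => k [D szD]; apply: treewidth_le.
pose bag (i : td_tree D) := [set h | B h :&: td_bag i != set0].
have bagP h i : reflect (exists2 x, x \in B h & x \in @td_bag _ D i) (h \in bag i).
  rewrite inE; apply: (iffP (set0Pn _)) => [[x]|[x xh xi]].
    by rewrite inE => /andP[]; exists x.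
  by exists x; rewrite inE xh.
have D' : {D' : tdec H | forall i, #|@td_bag _ D' i| <= k.+1}.
  unshelve eexists (@TDec H (td_tree D) bag (td_is_tree D) _ _ _).
  - move=> h; have /set0Pn[x xh] := B0 h; have [i xi] := td_cover D x.
    by exists i; apply/bagP; exists x.
  - move=> h h' /Badj[x [y [xh yh' /(td_edge D)[i /andP[xi yi]]]]]; exists i.
    by apply/andP; split; apply/bagP; [exists x | exists y].
  - move=> h i j /bagP[x xh xi] /bagP[y yh yj].
    set e := (X in connect X).
    have inT z a b : z \in B h -> z \in td_bag a -> z \in td_bag b -> connect e a b.
      move=> zh za zb; have := td_conn za zb; apply: connect_sub => c d.
      move=> /= /and3P[cd zc zd]; apply: connect1; rewrite /e /= cd /=.
      by apply/andP; split; apply/bagP; exists z.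
    have xy := Bconn _ _ _ xh yh; move: y xy j yj {yh}.
    apply: connect_ind => [j xj|y z _ IH /= /and3P[yz yh zh] j zj].
      exact: inT xj.
    have [l /andP[yl zl]] := td_edge D yz.
    exact: connect_trans (IH _ yl) (inT _ _ _ zh zl zj).
  - move=> i /=; apply: leq_trans (szD i).
    (* The new bag is covered by the image of the old one under the map sending a vertex to its
       branch set; [Some] makes room for vertices outside all branch sets. *)
    rewrite -(card_imset (mem (bag i)) Some_inj).
    apply: leq_trans (leq_imset_card (fun x => [pick h | x \in B h]) _).
    apply/subset_leq_card/subsetP=> _ /imsetP[h /bagP[x xh xi] ->].
    apply/imsetP; exists x => //; case: pickP => [h' xh'|/(_ h)]; last by rewrite xh.
    by congr Some; exact: Bdisj xh xh'.
by case: D' => D' szD'; exists D'.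
Qed.

(** * Connected graphs of large girth and large minimum degree *)

Definition girth_gt (G : sgraph) (g : nat) : Prop :=
  forall c : seq G, 2 < size c -> size c <= g -> uniq c -> ~ cycle adj c.

Section LargeGirth.

Variables (d r : nat).

Let word := r.+1.-bseq 'I_d.
Let reduced (w : seq 'I_d) := sorted [rel i j | i != j] w.

(* Multiplication by the i-th generator of the free product of d copies of Z/2,
   truncated to the ball of radius r+1; non-reduced words are junk and left fixed. *)
Definition flip_seq (i : 'I_d) (w : seq 'I_d) : seq 'I_d :=
  if ~~ reduced w then w else
  if ohead w == Some i then behead w else
  if size w <= r then i :: w else w.

Lemma size_flip_seq i (w : word) : size (flip_seq i w) <= r.+1.
Proof.
rewrite /flip_seq; case: ifP => _; first exact: size_bseq.
case: ifP => _; last by case: ifP => // _; apply: size_bseq.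
by rewrite size_behead (leq_trans (leq_pred _)) ?size_bseq.
Qed.

Definition flip i (w : word) : word := Bseq (size_flip_seq i w).

(** A reduced word starting with [i] no longer starts with [i] once that letter is removed, and
    prepending [i] to a reduced word not starting with [i] keeps it reduced; so the two operations
    undo each other. Words too long to be extended are fixed. *)
Lemma flipK i : involutive (flip i).
Proof.
move=> w; apply: val_inj => /=; have := size_bseq w; move: (bseqval w) => {}w.
rewrite {2}/flip_seq; case: ifPn => [nr _|]; first by rewrite /flip_seq nr.
rewrite negbK; case: w => [|j w] /= rw szw; first by rewrite /flip_seq /= eqxx.
case: eqP => [[ji]|ji].
  have rw' : reduced w by apply: path_sorted rw.
  rewrite /flip_seq rw' /= ji.
  case: w rw {rw'} szw => [|l w] //= /andP[jl _] szw.
  rewrite ifF; first by rewrite -ltnS szw.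
  by apply/eqP=> -[li]; rewrite ji li eqxx in jl.
case: ifP => szw'; last first.
  by rewrite /flip_seq /reduced /= rw /= szw'; case: eqP.
rewrite /flip_seq /reduced /= rw andbT; case: eqP => [ij|]; last by rewrite eqxx.
by case: ji; rewrite ij.
Qed.

Definition flip_perm i : {perm word} := perm (inv_inj (flipK i)).

Lemma flip_permK i : (flip_perm i * flip_perm i = 1)%g.
Proof. by apply/perm.permP=> w; rewrite permM !permE flipK. Qed.

(** Adjacency of the Cayley graph of the full symmetric group on words. The flips need not generate
    this group, so a connected component is taken later. *)
Definition cayley_adj : rel {perm word} :=
  [rel x y | [exists i, y == (x * flip_perm i)%g]].

Let nil_word : word := @Bseq r.+1 _ [::] isT.

Lemma flip_perm_nil i : flip_perm i nil_word = [:: i] :> seq _.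
Proof. by rewrite permE. Qed.

Lemma flip_perm_neq1 i : flip_perm i != 1%g.
Proof.
apply/eqP=> /perm.permP/(_ nil_word)/(congr1 (@bseqval _ _)).
by rewrite flip_perm_nil perm1.
Qed.

Lemma cayley_adj_sym : symmetric cayley_adj.
Proof.
suff sub x y : cayley_adj x y -> cayley_adj y x.
  by move=> x y; apply/idP/idP; apply: sub.
case/existsP=> i /eqP ->; apply/existsP; exists i.
by rewrite -mulgA flip_permK mulg1.
Qed.

Lemma cayley_adj_irr : irreflexive cayley_adj.
Proof.
move=> x; apply/existsP=> -[i]; rewrite -{1}[x]mulg1 (inj_eq (mulgI x)) eq_sym.
by rewrite (negPf (flip_perm_neq1 i)).
Qed.

Definition cayley_graph := SGraph cayley_adj_sym cayley_adj_irr.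

Lemma cayley_degree (x : cayley_graph) : d <= #|adj x|.
Proof.
pose nb i : {perm word} := (x * flip_perm i)%g.
have nb_inj : injective nb.
  move=> i j /mulgI/perm.permP/(_ nil_word)/(congr1 (@bseqval _ _)).
  by rewrite !flip_perm_nil => -[].
rewrite -[d in d <= _]card_ord -(card_image nb_inj).
apply/subset_leq_card/subsetP=> y /imageP[i _ ->]; rewrite inE.
by apply/existsP; exists i.
Qed.

(* Along a non-backtracking walk the image of the empty word spells the walk. *)
Lemma cayley_walk (x : {perm word}) p :
    path cayley_adj x p -> uniq (x :: p) -> size p <= r.+1 ->
  let w : word := (x^-1 * last x p)%g nil_word in
  [/\ reduced w, size w = size p &
      forall i, ohead w = Some i -> (last x p * flip_perm i)%g \in x :: p].
Proof.
elim/last_ind: p => [|p y IH] /=; first by rewrite mulVg perm1.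
rewrite rcons_path rcons_uniq last_rcons size_rcons mem_rcons inE negb_or.
move=> /andP[pp /existsP[i /eqP yE]] /and3P[/andP[xy xp] yp up] szp.
have [|rw szw hw] := IH pp _ (ltnW szp); first by rewrite /= xp.
have -> : (x^-1 * y = x^-1 * last x p * flip_perm i)%g by rewrite yE mulgA.
rewrite permM permE; set w := (fun_of_perm _ nil_word) in rw szw hw *.
(* Flipping the head letter of [w] would lead back to a visited vertex, whereas [y] is new; hence
   [i] is not the head and gets prepended. *)
have -> : bseqval (flip i w) = i :: w.
  rewrite /= /flip_seq rw /= szw -ltnS szp; case: eqP => // /hw.
  by rewrite -yE inE eq_sym (negPf xy) (negPf yp).
split=> /=.
- move: rw (hw i); rewrite /reduced; case: (bseqval w) => //= j s -> hj.
  rewrite andbT; apply/eqP=> ij; have := hj (congr1 Some (esym ij)).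
  by rewrite -yE inE eq_sym (negPf xy) (negPf yp).
- by rewrite szw.
- move=> j [<-]; rewrite yE -mulgA flip_permK mulg1 in_cons mem_rcons inE.
  by have := mem_last x p; rewrite inE => /orP[->|->]; rewrite ?orbT.
Qed.

(** The cycle without its closing edge spells a word of length at least 2. The closing edge would
    turn this word into the empty one, but a flip removes at most one letter. *)
Lemma cayley_girth : girth_gt cayley_graph r.
Proof.
case=> [|x p] // sz3 szr uc; rewrite (cycle_path x) => /= /andP[/existsP[i /eqP xE] pp].
have szp : size p <= r.+1 by rewrite -ltnS (leq_trans szr) // ltnW.
have [_ szw _] := cayley_walk pp uc szp.
have : flip i ((x^-1 * last x p)%g nil_word) = nil_word.
  rewrite -(permE (inv_inj (flipK i))) -[perm _]/(flip_perm i) -permM -mulgA -xE.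
  by rewrite mulVg perm1.
move/(congr1 (fun w : word => size w)) => /=; set w := (fun_of_perm _ nil_word) in szw *.
move: sz3; rewrite /= -szw; case: (bseqval w) => [|? [|? ?]] // _.
by rewrite /flip_seq; do 3![case: ifP => _ //].
Qed.

End LargeGirth.

Section Component.

Variables (G : sgraph) (x0 : G).

Definition component_adj : rel {x : G | connect adj x0 x} :=
  [rel x y | adj (val x) (val y)].

Lemma component_adj_sym : symmetric component_adj.
Proof. by move=> x y; apply: adj_sym. Qed.

Lemma component_adj_irr : irreflexive component_adj.
Proof. by move=> x; apply: adj_irr. Qed.

Definition component := SGraph component_adj_sym component_adj_irr.

Lemma component_connected : connected component.
Proof.
pose r0 : component := exist _ x0 (connect0 adj x0).
split; first by apply/card_gt0P; exists r0.
have fromr : forall z, connect adj x0 z -> forall zP : connect adj x0 z,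
    connect (@adj component) r0 (exist _ z zP).
  apply: connect_ind => [zP|y z yP IH yz zP].
    by rewrite (bool_irrelevance zP (connect0 adj x0)) connect0.
  exact: connect_trans (IH yP) (connect1 _).
have csym : connect_sym (@adj component) by apply: sym_connect_sym; apply: adj_sym.
move=> [x xP] [y yP]; apply: connect_trans (fromr _ yP yP).
by rewrite csym fromr.
Qed.

Lemma component_girth g : girth_gt G g -> girth_gt component g.
Proof.
move=> gG c c3 cg uc cc; apply: (gG (map val c)); rewrite ?size_map //.
  by rewrite map_inj_uniq //; apply: val_inj.
by rewrite cycle_map.
Qed.

Lemma component_degree d : (forall x : G, d <= #|adj x|) ->
  forall x : component, d <= #|adj x|.
Proof.
move=> dG [x xP]; apply: leq_trans (dG x) _.
rewrite -(card_image val_inj); apply/subset_leq_card/subsetP=> y xy.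
apply/imageP; exists (exist _ y (connect_trans xP (connect1 xy))) => //.
Qed.

End Component.

Lemma large_girth_graph (d g : nat) :
  exists A : sgraph, [/\ connected A, girth_gt A g & forall x : A, d <= #|adj x|].
Proof.
exists (@component (cayley_graph d g) 1%g); split.
- exact: component_connected.
- exact/component_girth/cayley_girth.
- exact/component_degree/cayley_degree.
Qed.

(** * The pebble game on cliques with glued copies *)

Definition update (T : Type) (a : nat -> T) (x : nat) (v : T) : nat -> T :=
  fun z => if z == x then v else a z.

(** [R] is a set of winning positions for Duplicator in the game with one pebble for each variable
    in [V]. Assignments are total, but only their values on [V] are compared. *)
Lemma back_and_forth (G H : sgraph) (V : seq nat) (R : (nat -> G) -> (nat -> H) -> Prop) :
    (forall a b, R a b -> forall x y, x \in V -> y \in V ->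
       (a x = a y <-> b x = b y) /\ adj (a x) (a y) = adj (b x) (b y)) ->
    (forall a b x v, R a b -> x \in V -> exists w, R (update a x v) (update b x w)) ->
    (forall a b x w, R a b -> x \in V -> exists v, R (update a x v) (update b x w)) ->
  forall f a b, {subset all_vars f <= V} -> R a b -> sat a f <-> sat b f.
Proof.
move=> atoms forth back.
elim=> [x y|x y|f IH|f IHf g IHg|f IHf g IHg|x f IH|x f IH] a b fV Rab /=.
- by have [] // := atoms _ _ Rab x y; apply: fV; rewrite !inE eqxx ?orbT.
- by have [| |_ ->] // := atoms _ _ Rab x y; apply: fV; rewrite !inE eqxx ?orbT.
- by rewrite (IH _ _ _ Rab).
- rewrite (IHf _ _ _ Rab); first rewrite (IHg _ _ _ Rab) //.
    by move=> z zg; apply: fV; rewrite mem_cat zg orbT.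
  by move=> z zf; apply: fV; rewrite mem_cat zf.
- rewrite (IHf _ _ _ Rab); first rewrite (IHg _ _ _ Rab) //.
    by move=> z zg; apply: fV; rewrite mem_cat zg orbT.
  by move=> z zf; apply: fV; rewrite mem_cat zf.
- have xV : x \in V by apply: fV; rewrite inE eqxx.
  have fV' : {subset all_vars f <= V} by move=> z zf; apply: fV; rewrite inE zf orbT.
  split=> [[v sv]|[w sw]].
    by have [w Rw] := forth _ _ x v Rab xV; exists w; apply/(IH _ _ fV' Rw).
  by have [v Rv] := back _ _ x w Rab xV; exists v; apply/(IH _ _ fV' Rv).
- have xV : x \in V by apply: fV; rewrite inE eqxx.
  have fV' : {subset all_vars f <= V} by move=> z zf; apply: fV; rewrite inE zf orbT.
  split=> [sa w|sb v].
    by have [v Rv] := back _ _ x w Rab xV; apply/(IH _ _ fV' Rv); apply: sa.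
  by have [w Rw] := forth _ _ x v Rab xV; apply/(IH _ _ fV' Rw); apply: sb.
Qed.

Section RootedProduct.

Variables (A : sgraph) (r : A).

Definition rooted_adj (n : nat) : rel ('I_n * A) := fun u v =>
  (u.1 == v.1) && adj u.2 v.2 || [&& u.1 != v.1, u.2 == r & v.2 == r].

Lemma rooted_adj_sym n : symmetric (@rooted_adj n).
Proof.
by move=> u v; rewrite /rooted_adj eq_sym adj_sym [_ && (_ == r)]andbC.
Qed.

Lemma rooted_adj_irr n : irreflexive (@rooted_adj n).
Proof. by move=> u; rewrite /rooted_adj eqxx adj_irr. Qed.

(* K_n with a copy of A glued by its root r to every vertex. *)
Definition rooted_product n := SGraph (@rooted_adj_sym n) (@rooted_adj_irr n).

Lemma rooted_product_degree d n : (forall a : A, d <= #|adj a|) ->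
  forall x : rooted_product n, d <= #|adj x|.
Proof.
move=> dA [i a]; apply: leq_trans (dA a) _.
have inj : injective (fun b : A => (i, b)) by move=> b c [].
rewrite -(card_image inj); apply/subset_leq_card/subsetP=> _ /imageP[b ab ->].
by rewrite -topredE /= /rooted_adj /= eqxx; move: ab; rewrite -topredE /= => ->.
Qed.

Lemma rooted_product_connected n : connected A -> connected (rooted_product n.+1).
Proof.
move=> [_ cA]; split; first by apply/card_gt0P; exists (ord0, r).
have copy i a b : connect (@adj (rooted_product n.+1)) (i, a) (i, b).
  move: b (cA a b); apply: connect_ind => [|b c _ ab bc]; first exact: connect0.
  by apply: connect_trans ab (connect1 _); rewrite /= /rooted_adj /= eqxx bc.
move=> [i a] [j b]; have [->|ij] := eqVneq i j; first exact: copy.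
apply: connect_trans (copy i a r) _; apply: connect_trans (copy j r b).
by apply: connect1; rewrite /= /rooted_adj /= ij !eqxx orbT.
Qed.

(** The invariant of the game: equality and adjacency of two pebbled vertices depend only on their
    coordinates in [A] and on whether their clique coordinates agree. *)
Definition same_type (V : seq nat) n m
    (a : nat -> rooted_product n) (b : nat -> rooted_product m) : Prop :=
  forall x y, x \in V -> y \in V ->
    (a x).2 = (b x).2 /\ ((a x).1 == (a y).1) = ((b x).1 == (b y).1).

Lemma same_type_sym V n m (a : nat -> rooted_product n) (b : nat -> rooted_product m) :
  same_type V a b -> same_type V b a.
Proof. by move=> ab x y xV yV; have [-> ->] := ab x y xV yV. Qed.

(** The moved pebble leaves its place, so the others occupy at most m-1 of the m clique vertices.
    Duplicator copies the coordinate in [A] and either joins a pebble on the matching clique vertex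
    or uses a free one. *)
Lemma same_type_forth V n m (a : nat -> rooted_product n) (b : nat -> rooted_product m)
    x v : size (undup V) <= m -> x \in V -> same_type V a b ->
  exists w, same_type V (update a x v) (update b x w).
Proof.
move=> Vm xV ab; case: v => i c.
suff [j jP] : exists j, forall y, y \in V -> y != x -> ((a y).1 == i) = ((b y).1 == j).
  exists (j, c) => y z yV zV; rewrite /update.
  have [yx|yx] := eqVneq y x; have [zx|zx] := eqVneq z x; rewrite /= ?eqxx //.
  - by rewrite eq_sym jP // eq_sym.
  - by have [-> _] := ab y z yV zV; rewrite jP.
  - exact: ab.
have [[y yV /andP[yx /eqP ay]]|none] :=
    pselect (exists2 y, y \in V & (y != x) && ((a y).1 == i)).
  by exists (b y).1 => z zV zx; have [_ <-] := ab z y zV yV; rewrite ay.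
pose used := [seq (b y).1 | y <- rem x (undup V)].
have : #|used| < #|'I_m|.
  rewrite card_ord; apply: leq_ltn_trans (card_size _) _.
  rewrite size_map size_rem ?mem_undup //; apply: leq_trans Vm.
  by rewrite ltn_predL; move: xV; rewrite -mem_undup; case: (undup V).
move=> lt; have /existsP[j jn] : [exists j, j \notin used].
  apply: contraLR lt => /existsPn all; rewrite -leqNgt.
  by apply/subset_leq_card/subsetP=> j _; rewrite -[_ \in _]negbK all.
exists j => y yV yx.
have -> : ((a y).1 == i) = false.
  by apply/negP=> ay; apply: none; exists y; rewrite ?yx.
apply/esym/negP=> /eqP byj; move/negP: jn; apply; rewrite -byj.
by apply: map_f; rewrite mem_rem_uniq ?undup_uniq // !inE yx mem_undup.
Qed.

Lemma same_type_sat (f : form) n m (a : nat -> rooted_product n) (b : nat -> rooted_product m) :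
  var_width f <= n -> var_width f <= m -> same_type (all_vars f) a b ->
  sat a f <-> sat b f.
Proof.
move=> fn fm ab.
apply: (@back_and_forth _ _ (all_vars f) (@same_type (all_vars f) n m) _ _ _ _ _ _ _ ab)
  => // {ab}.
- move=> {}a {}b ab x y xV yV; have [ax axy] := ab x y xV yV; have [ay _] := ab y x yV xV.
  split; last by rewrite /= /rooted_adj ax ay axy.
  move: ax ay axy; case: (a x) (a y) (b x) (b y) => [i c] [j d] [k e] [l h] /= -> -> ijkl.
  by split=> -[/eqP ij ->]; [rewrite ijkl in ij | rewrite -ijkl in ij]; rewrite (eqP ij).
- by move=> {}a {}b x v ab xV; apply: same_type_forth.
- move=> {}a {}b x v ab xV; have [w] := same_type_forth v fn xV (same_type_sym ab).
  by exists w; apply: same_type_sym.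
Qed.

Lemma rooted_product_models (f : form) n : var_width f <= n ->
  models (rooted_product n.+1) f -> models (rooted_product n) f.
Proof.
move=> fn fG b; pose a x : rooted_product n.+1 := (widen_ord (leqnSn n) (b x).1, (b x).2).
suff ab : same_type (all_vars f) a b by apply/(same_type_sat (leqW fn) fn ab).
by move=> x y _ _.
Qed.

(** A core vertex placed off the root has all its core neighbours in the same copy of [A]. So if
    some core vertex is off the root, the part of the core in its copy has minimum degree at least 2
    except possibly at [r], and thus contains a cycle on at most v(F) vertices, against the
    girth. *)
Lemma core_in_clique n (F : sgraph) (S : {set F}) (f : F -> rooted_product n) :
    girth_gt A #|F| -> injective f -> (forall x y, adj x y -> adj (f x) (f y)) ->
    (forall x, x \in S -> 1 < deg_in S x) ->
  forall x, x \in S -> (f x).2 = r.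
Proof.
move=> gA f_inj f_adj Sdeg x xS; apply: contrapT => /eqP xr.
pose i := (f x).1; pose P := [set y in S | (f y).1 == i]; pose S' := [set (f y).2 | y in P].
have szS' : #|S'| <= #|F| by apply: leq_trans (leq_imset_card _ _) (max_card _).
have degS' a : a \in S' -> a != r -> 1 < deg_in S' a.
  case/imsetP=> y; rewrite inE => /andP[yS /eqP yi] -> ar.
  have nb z : z \in S -> adj y z -> (f z).1 = i /\ adj (f y).2 (f z).2.
    move=> zS /f_adj /=; rewrite /rooted_adj (negPf ar) andbF orbF yi.
    by case/andP=> /eqP -> ->.
  apply: leq_trans (Sdeg y yS) _; rewrite /deg_in.
  rewrite -(@card_in_imset _ _ (fun z => (f z).2)); last first.
    move=> z t; rewrite !inE => /andP[zS yz] /andP[tS yt] /= zt; apply: f_inj.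
    have [z1 _] := nb _ zS yz; have [t1 _] := nb _ tS yt.
    by rewrite [f z]surjective_pairing [f t]surjective_pairing z1 t1 zt.
  apply/subset_leq_card/subsetP=> _ /imsetP[z + ->]; rewrite inE => /andP[zS yz].
  have [z1 yz'] := nb _ zS yz; rewrite inE yz' andbT.
  by apply/imsetP; exists z; rewrite // inE zS z1 /=.
have xS' : (f x).2 \in S' by apply/imsetP; exists x; rewrite // inE xS /=.
have no_cycle c : 2 < size c -> uniq c -> {subset c <= S'} -> ~ cycle adj c.
  move=> c3 uc cS; apply: gA => //; apply: leq_trans szS'.
  by rewrite -(card_uniqP uc); apply/subset_leq_card/subsetP.
have [/andP[rS /existsP[y /andP[yS ry]]]|nr] :=
    boolP ((r \in S') && [exists y in S', adj r y]).
  have [c [c3 uc cS cc]] := cycle_of_min_degree rS yS ry degS'.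
  exact: no_cycle cc.
have degS'' a : a \in S' :\ r -> 1 < deg_in (S' :\ r) a.
  rewrite !inE => /andP[ar aS]; apply: leq_trans (degS' _ aS ar) _.
  apply/subset_leq_card/subsetP=> b; rewrite !inE => /andP[bS ab]; rewrite bS ab !andbT.
  apply: contra nr => /eqP br; rewrite -br bS /=; apply/existsP; exists a.
  by rewrite aS adj_sym.
have xS'' : (f x).2 \in S' :\ r by rewrite !inE xr.
have /card_gt0P[y] := ltnW (degS'' _ xS''); rewrite inE => /andP[yS xy].
have [c [c3 uc cS cc]] := cycle_of_min_degree xS'' yS xy (fun a aS _ => degS'' a aS).
by apply: (no_cycle c) => // a /cS; rewrite inE => /andP[].
Qed.

End RootedProduct.

(** * Greedy extension from the core, and the first bound *)

Definition embeds_on (F G : sgraph) (S : {set F}) (f : F -> G) : Prop :=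
  {in S &, injective f} /\ {in S &, forall x y, adj x y -> adj (f x) (f y)}.

(** The vertex put back has at most one placed neighbour. The image of that neighbour has at least
    v(F) neighbours, while fewer than v(F) vertices are in use, so a fresh one is available. *)
Lemma embeds_on_unpeel (F G : sgraph) (S S' : {set F}) (f : F -> G) :
    (forall x : G, #|F| <= #|adj x|) -> 0 < #|G| -> peel_step S S' -> embeds_on S' f ->
  exists g : F -> G, embeds_on S g.
Proof.
move=> dG /card_gt0P[g0 _] /existsP[x /and3P[xS dx /eqP ->]] [f_inj f_adj].
pose used := [set f y | y in S :\ x].
have szu : #|used| < #|F|.
  apply: leq_ltn_trans (leq_imset_card _ _) _.
  by apply: leq_trans (max_card S); rewrite [X in _ < X](cardsD1 x) xS.
have fresh u : exists2 v : G, adj u v & v \notin used.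
  have : ~~ (adj u \subset used).
    apply: contraL szu => /subset_leq_card; rewrite -leqNgt; exact: leq_trans (dG u).
  by case/subsetPn=> v; exists v.
have [v nbv vn] : exists2 v : G, forall y, y \in S -> adj x y -> adj v (f y) & v \notin used.
  have [/set0Pn[p]|] := boolP ([set y in S | adj x y] != set0).
    rewrite inE => /andP[pS xp]; have [v pv vn] := fresh (f p); exists v => // y yS xy.
    move/card_le1_eqP: dx => /(_ p y) ->; rewrite ?inE ?yS ?pS //.
    by rewrite adj_sym.
  rewrite negbK => /eqP none; have [v _ vn] := fresh g0; exists v => // y yS xy.
  by have := in_set0 y; rewrite -none inE yS xy.
have inD y : y \in S -> y != x -> y \in S :\ x by move=> *; rewrite !inE; apply/andP.
have fv y : y \in S -> y != x -> f y != v.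
  by move=> yS yx; apply: contraNneq vn => <-; apply: imset_f; apply: inD.
exists (fun y => if y == x then v else f y); split=> y z yS zS.
  have [->|yx] := eqVneq y x; have [->|zx] := eqVneq z x => //.
  - by move/esym/eqP; rewrite (negPf (fv _ _ _)).
  - by move/eqP; rewrite (negPf (fv _ _ _)).
  - by apply: f_inj; apply: inD.
have [->|yx] := eqVneq y x; have [->|zx] := eqVneq z x.
- by rewrite adj_irr.
- exact: nbv.
- by rewrite adj_sym (adj_sym (f y)); apply: nbv.
- by apply: f_adj; apply: inD.
Qed.

Lemma core_extends (F G : sgraph) (S : {set F}) (f : F -> G) :
    (forall x : G, #|F| <= #|adj x|) -> 0 < #|G| ->
    connect (@peel_step F) setT S -> embeds_on S f ->
  contains G F.
Proof.
move=> dG G0 TS fS.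
have : forall S, connect (@peel_step F) setT S ->
    (exists f : F -> G, embeds_on S f) -> contains G F.
  apply: connect_ind => [[g [g_inj g_adj]]|U U' _ IH UU' [g gU']].
    by exists g; split=> [x y|x y]; [apply: g_inj | apply: g_adj].
  by apply: IH; apply: embeds_on_unpeel UU' gU'.
by apply; [exact: TS | exists f].
Qed.

Lemma core_bound (F : sgraph) (F0 : {set F}) : is_core F0 -> Wtw_ge F #|F0|.
Proof.
move=> [peelF0 degF0] Phi [_ [k defPhi]]; rewrite leqNgt; apply/negP=> widthPhi.
(* The smaller graph is built on a clique with one vertex less than the core, which must be nonempty
   to give a connected graph. A core of size 1 is impossible, since its vertex would need two
   neighbours in the core. *)
case ell : #|F0| widthPhi => [|[|n]] // widthPhi.
  have /card_gt0P[x /degF0 dx] : 0 < #|F0| by rewrite ell.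
  have := subset_leq_card (subsetIl F0 [set y | adj x y]).
  by rewrite -setIdE ell leqNgt dx.
(* Degree at least [k] forces the treewidth up, and degree at least v(F) serves the greedy
   extension. *)
have [A [cA gA dA]] := large_girth_graph (maxn k #|F|) #|F|.
have /card_gt0P[r _] := cA.1.
have dk m (x : rooted_product r m) : k <= #|adj x|.
  by apply: rooted_product_degree => a; apply: leq_trans (dA a); apply: leq_maxl.
have dF m (x : rooted_product r m) : #|F| <= #|adj x|.
  by apply: rooted_product_degree => a; apply: leq_trans (dA a); apply: leq_maxr.
have cG m : connected (rooted_product r m.+1) by apply: rooted_product_connected.
have twG m : k <= treewidth (rooted_product r m.+1).
  by apply: treewidth_min_degree => //; have [] := cG m.
have GF : contains (rooted_product r n.+2) F.
  have /card_gt0P[x0 x0F] : 0 < #|F0| by rewrite ell.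
  pose idx x := cast_ord ell (enum_rank_in x0F x).
  have idx_inj : {in F0 &, injective idx}.
    by move=> x y xF yF /cast_ord_inj/enum_rank_in_inj; apply.
  apply: (@core_extends F (rooted_product r n.+2) F0 (fun x => (idx x, r))) => //; first by have [] := cG n.+1.
  split=> x y xF yF; first by move/(congr1 fst)/idx_inj; apply.
  move=> xy; rewrite /= /rooted_adj /= !eqxx !andbT; apply/orP; right.
  by apply/eqP=> /idx_inj xyE; rewrite xyE // adj_irr in xy.
have HPhi : models (rooted_product r n.+1) Phi.
  by apply: rooted_product_models => //; apply/defPhi.
have [f [f_inj f_adj]] := (defPhi _ (cG n) (twG n)).1 HPhi.
have froot := core_in_clique gA f_inj f_adj degF0.
have : #|[set (f x).1 | x in F0]| <= #|'I_n.+1| by apply: max_card.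
rewrite card_in_imset ?ell ?card_ord ?ltnn // => x y xF yF xy.
by apply: f_inj; rewrite [f x]surjective_pairing [f y]surjective_pairing !froot // xy.
Qed.

(** * Treewidth in terms of the core *)

Lemma core_exists (F : sgraph) : exists F0 : {set F}, is_core F0.
Proof.
case: (@arg_minnP _ [set: F] (connect (@peel_step F) setT) (fun S => #|S|)).
  exact: connect0.
move=> S TS Smin; exists S; split=> // x xS; rewrite ltnNge; apply/negP=> dx.
have : #|S| <= #|S :\ x|.
  apply: Smin; apply: connect_trans TS (connect1 _).
  by apply/existsP; exists x; rewrite xS dx eqxx.
by rewrite (cardsD1 x) xS ltnn.
Qed.

(** A vertex on a cycle inside the current set has degree at least 2 there, so it is never peeled,
    and the whole cycle survives to the end. *)
Lemma empty_core_acyclic (F : sgraph) : is_core (set0 : {set F}) -> acyclic F.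
Proof.
move=> [T0 _] [c [c3 uc cc]].
have sub0 : {subset c <= (set0 : {set F})}.
  move: set0 T0; apply: connect_ind => [x _|S S' _ cS]; first by rewrite inE.
  case/existsP=> x /and3P[xS dx /eqP ->] y yc; rewrite !inE cS // andbT.
  apply: contraTneq dx => yx; rewrite -ltnNge; rewrite yx in yc.
  have [i p cE] := rot_to yc.
  move: (c3) (uc) (cc); rewrite -(size_rot i) -(rot_uniq i) -(rot_cycle i) cE.
  case: p cE => [|a [|b p]] //= cE _ /and3P[_ ap _] /andP[xa].
  rewrite rcons_path => /and3P[_ _ bx].
  have inS z : z \in [:: a, b & p] -> z \in S.
    by move=> zp; apply: cS; rewrite -(mem_rot i) cE inE zp orbT.
  suff : #|[set a; last b p]| <= deg_in S x.
    rewrite cards2; case: eqP => // ab; move: ap.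
    by rewrite ab mem_last.
  apply/subset_leq_card/subsetP=> z; rewrite !inE => /orP[] /eqP ->.
    by rewrite xa inS // inE eqxx.
  by rewrite adj_sym bx inS // inE mem_last orbT.
by case: c c3 sub0 {uc cc} => [|x c] // _ /(_ x); rewrite !inE eqxx => /(_ isT).
Qed.

Section Pendant.

Variables (T : sgraph) (i0 : T).

Definition pendant_adj : rel (option T) := fun u v =>
  match u, v with
  | Some a, Some b => adj a b
  | Some a, None | None, Some a => a == i0
  | None, None => false
  end.

Lemma pendant_adj_sym : symmetric pendant_adj.
Proof. by move=> [a|] [b|] //=; apply: adj_sym. Qed.

Lemma pendant_adj_irr : irreflexive pendant_adj.
Proof. by move=> [a|] //=; apply: adj_irr. Qed.

Definition pendant := SGraph pendant_adj_sym pendant_adj_irr.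

(** On a cycle the new vertex would have two distinct neighbours, but [i0] is its only one; so every
    cycle already lies in [T]. *)
Lemma pendant_tree : is_tree T -> is_tree pendant.
Proof.
move=> [[_ cT] aT]; split; [split|].
- by apply/card_gt0P; exists None.
- have fromS a b : connect (@adj pendant) (Some a) (Some b).
    move: b (cT a b); apply: connect_ind => [|b c _ ab bc]; first exact: connect0.
    exact: connect_trans ab (connect1 _).
  have S0 : connect (@adj pendant) (Some i0) None by apply: connect1; rewrite /= eqxx.
  have O0 : connect (@adj pendant) None (Some i0) by apply: connect1; rewrite /= eqxx.
  move=> [a|] [b|] //.
  + exact: connect_trans (fromS _ _) S0.
  + exact: connect_trans O0 (fromS _ _).
- move=> [c [c3 uc cc]]; have [/rot_to[i p cE]|nc] := boolP (None \in c).
    move: c3 uc cc; rewrite -(size_rot i) -(rot_uniq i) -(rot_cycle i) cE.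
    case: p {cE} => [|a [|b p]] //= _ /and3P[_ ap _]; rewrite rcons_path.
    case: a ap => // a ap /and4P[/eqP a0 _ _]; case lbp: (last b p) => [l|] //= /eqP l0.
    by move: ap; rewrite a0 -l0 -lbp mem_last.
  have cE : c = map Some (pmap id c).
    by elim: c nc {c3 uc cc} => [|[a|] c IH] //=; rewrite inE //= => /IH {1}->.
  apply: aT; exists (pmap id c); move: c3 uc cc; rewrite {1 2 3}cE size_map.
  by rewrite (map_inj_uniq Some_inj) cycle_map.
Qed.

End Pendant.

(** Bounds the treewidth of the subgraph induced on [S]. The bags are sets of vertices of [F]
    itself, so that putting a peeled vertex back changes only [S]. *)
Definition tw_le_on (F : sgraph) (S : {set F}) (k : nat) : Prop :=
  exists (T : sgraph) (bag : T -> {set F}),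
  [/\ is_tree T, forall i, #|bag i| <= k.+1 /\ bag i \subset S,
      forall v, v \in S -> exists i, v \in bag i,
      forall x y, x \in S -> y \in S -> adj x y ->
        exists i, (x \in bag i) && (y \in bag i) &
      forall v i j, v \in bag i -> v \in bag j ->
        connect [rel a b | [&& adj a b, v \in bag a & v \in bag b]] i j].

Lemma tw_le_on_card (F : sgraph) (S : {set F}) k : #|S| <= k.+1 -> tw_le_on S k.
Proof.
move=> Sk; exists unit_graph, (fun _ => S); split=> //.
- exact: unit_graph_tree.
- by move=> x y xS yS _; exists tt; rewrite xS.
- by move=> v [] [] _ _; apply: connect0.
Qed.

(** The vertex put back and its at most one neighbour form a bag of size at most 2, hung as a leaf
    on a node whose bag contains this neighbour. This is where k must be positive. *)
Lemma tw_le_on_unpeel (F : sgraph) (S S' : {set F}) k :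
  0 < k -> peel_step S S' -> tw_le_on S' k -> tw_le_on S k.
Proof.
move=> k0 /existsP[x /and3P[xS dx /eqP ->]] [T [bag [treeT szb cov edg con]]].
pose N := [set y in S | adj x y].
have [i0 i0N] : exists i0, N \subset bag i0.
  have [N0|/set0Pn[p pN]] := eqVneq N set0.
    by have /card_gt0P[i0 _] := treeT.1.1; exists i0; rewrite N0 sub0set.
  have pSx : p \in S :\ x.
    move: pN; rewrite !inE => /andP[-> xp]; rewrite andbT.
    by apply: contraTneq xp => ->; rewrite adj_irr.
  have [i0 pi0] := cov p pSx; exists i0; apply/subsetP=> y yN.
  by move/card_le1_eqP: dx => /(_ p y pN yN) ->.
pose bag' (u : pendant i0) := if u is Some i then bag i else x |: N.
have xbag i : x \notin bag i.
  by apply/negP=> xi; have /subsetP/(_ x xi) := (szb i).2; rewrite !inE eqxx.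
exists (pendant i0), bag'; split.
- exact: pendant_tree.
- case=> [i|] /=.
    by have [-> iS] := szb i; split=> //; apply: subset_trans iS (subsetDl _ _).
  split.
    rewrite cardsU1; apply: leq_trans (leq_add (leq_b1 _) dx) _.
    by rewrite ltnS.
  by apply/subsetP=> y; rewrite !inE => /predU1P[->//|/andP[]].
- move=> v vS; have [->|vx] := eqVneq v x; first by exists None; rewrite /= !inE eqxx.
  by have [|i vi] := cov v; [rewrite !inE vx | exists (Some i)].
- have edgex y : y \in S -> adj x y -> (x \in bag' None) && (y \in bag' None).
    by move=> yS xy; rewrite /= !inE eqxx yS xy orbT.
  move=> y z yS zS yz; have [yx|yx] := eqVneq y x.
    by exists None; rewrite yx in yz *; apply: edgex.
  have [zx|zx] := eqVneq z x.
    by exists None; rewrite zx in yz *; rewrite andbC; apply: edgex; rewrite // adj_sym.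
  have [| |i yzi] := edg y z _ _ yz; rewrite ?inE ?yx ?zx //.
  by exists (Some i).
- move=> v; set e := (X in connect X).
  have old a b : v \in bag a -> v \in bag b -> connect e (Some a) (Some b).
    move=> va vb; have ab := con v a b va vb; move: b ab {vb}.
    apply: connect_ind => [|b c _ ab bc]; first exact: connect0.
    exact: connect_trans ab (connect1 _).
  have e_sym : connect_sym e.
    by apply: sym_connect_sym => a b; rewrite /e /= pendant_adj_sym [(_ \in _) && _]andbC.
  have new a : v \in bag a -> v \in bag' None -> connect e None (Some a).
    move=> va; rewrite /= !inE => /predU1P[vx|vN].
      by have := xbag a; rewrite -vx va.
    have vi0 : v \in bag i0 by apply: (subsetP i0N); rewrite inE.
    apply: connect_trans (old _ _ vi0 va); apply: connect1.
    by rewrite /e /= eqxx vi0 !inE vN orbT.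
  move=> [a|] [b|] va vb.
  + exact: old.
  + by rewrite e_sym new.
  + exact: new.
  + exact: connect0.
Qed.

Lemma treewidth_core (F : sgraph) (F0 : {set F}) k :
  is_core F0 -> 0 < k -> #|F0| <= k.+1 -> treewidth F <= k.
Proof.
move=> [TF0 _] k0 szF0; apply: treewidth_le.
have : forall S, connect (@peel_step F) setT S -> tw_le_on S k -> tw_le F k.
  apply: connect_ind => [[T [bag [treeT szb cov edg con]]]|S S' _ IH SS' S'k].
    have cov' v : exists i, v \in bag i by apply: cov.
    have edg' x y : adj x y -> exists i, (x \in bag i) && (y \in bag i) by apply: edg.
    by exists (TDec treeT cov' edg' con) => i; have [] := szb i.
  by apply: IH; apply: tw_le_on_unpeel SS' S'k.
by apply; [exact: TF0 | apply: tw_le_on_card].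
Qed.

(** * Subdivided graphs of maximum degree three with a large clique minor *)

Section GluedMegastars.

Variables (C : finType) (s : nat) (tau : C * 'I_3 -> C * 'I_3).
Hypothesis tauK : involutive tau.

(** Arms have s+1 vertices, so index [s] marks the end of an arm. The final inequality makes a fixed
    point of [tau] a free end instead of a loop. *)
Definition glued_adj : rel (C * option ('I_3 * 'I_s.+1)) := fun u v =>
  (u.1 == v.1) && mstar_adj u.2 v.2 ||
  match u.2, v.2 with
  | Some (i, j), Some (i', j') =>
      [&& j == s :> nat, j' == s :> nat, tau (u.1, i) == (v.1, i') & (u.1, i) != (v.1, i')]
  | _, _ => false
  end.

Lemma glued_adj_sym : symmetric glued_adj.
Proof.
move=> [c p] [c' p']; rewrite /glued_adj /= eq_sym mstar_adj_sym; congr (_ || _).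
case: p p' => [[i j]|] [[i' j']|] //=.
rewrite andbCA [(c, i) == _]eq_sym; congr [&& _, _, _ & _].
by apply/eqP/eqP=> <-; rewrite tauK.
Qed.

Lemma glued_adj_irr : irreflexive glued_adj.
Proof.
move=> [c p]; rewrite /glued_adj /= mstar_adj_irr andbF /=.
by case: p => [[i j]|] //; rewrite !eqxx /= !andbF.
Qed.

(* A copy of M_{3,s+1} for each c : C, where the ends of the arms (c, i) and
   tau (c, i) are joined by an edge: a subdivision of the multigraph with darts C * 'I_3. *)
Definition glued_megastars := SGraph glued_adj_sym glued_adj_irr.

(** A connected piece with at most s+1 vertices that contains a centre is too small to reach the end
    of an arm, so it lies in one megastar. A piece without centre lies in two arms joined at their
    ends, that is, in a path, and fits into one long arm. *)
Lemma small_in_glued_megastars (F : sgraph) :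
    connected F -> #|F| <= s.+1 -> contains glued_megastars F ->
  exists b, contains (megastar 3 b) F.
Proof.
move=> [F0 cF] szF [f [f_inj f_adj]].
have [[x0 x0c]|nocentre] := pselect (exists x, (f x).2 = None).
  pose c := (f x0).1.
  pose depth (p : option ('I_3 * 'I_s.+1)) := if p is Some (_, j) then j.+1 else 0.
  (* The distance from the centre grows by at most one along an edge, and the joining edges have
     both ends at depth s+1, out of reach. *)
  have walk : forall p x, path adj x p -> (f x).1 = c -> depth (f x).2 + size p <= s ->
      (f (last x p)).1 = c /\ depth (f (last x p)).2 <= s.
    elim=> [|y p IH] x /=; first by rewrite addn0.
    move=> /andP[/f_adj xy pp] xc xs; apply: IH => //.
      move: xy xc xs; rewrite /= /glued_adj; case: (f x) (f y) => [cx px] [cy py] /=.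
      case: px py => [[i j]|] [[i' j']|] //=; rewrite ?orbF; try by case/andP=> /eqP ->.
      case/orP=> [/andP[/eqP -> //]|/and4P[/eqP -> _ _ _]] _; lia.
    move: xy xc xs; rewrite /= /glued_adj; case: (f x) (f y) => [cx px] [cy py] /=.
    case: px py => [[i j]|] [[i' j']|] //=; rewrite ?orbF.
    - case/orP=> [/and3P[_ _ /orP[]]|/and4P[/eqP -> _ _ _]] *; lia.
    - move=> *; lia.
    - by case/andP=> _ /eqP *; lia.
    - by rewrite andbF.
  have inball y : (f y).1 = c /\ depth (f y).2 <= s.
    have /connectP[p pp ->] := cF x0 y; case/shortenP: pp => q pq uq _.
    apply: walk => //; rewrite x0c add0n -ltnS; apply: leq_trans szF.
    by have := max_card (mem (x0 :: q)); rewrite (card_uniqP uq).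
  exists s.+1, (fun y => (f y).2); split=> [y z yz|y z /f_adj].
    apply: f_inj; rewrite [f y]surjective_pairing [f z]surjective_pairing yz.
    by have [-> _] := inball y; have [-> _] := inball z.
  rewrite /= /glued_adj; have [_] := inball y; case: (f y) (f z) => [cy py] [cz pz] /=.
  case: py pz => [[i j]|] [[i' j']|] //=; rewrite ?orbF => js; try by case/andP.
  by case/orP=> [/andP[] //|/and4P[/eqP jE _ _ _]]; rewrite jE ltnn in js.
(* The values at centres are dummies, as no centre is in the image. *)
pose dart (u : glued_megastars) : C * 'I_3 := (u.1, if u.2 is Some (i, _) then i else ord0).
pose pos (u : glued_megastars) : nat := if u.2 is Some (_, j) then j : nat else 0.
have edge y z : adj y z ->
    dart (f z) = dart (f y) /\ ((pos (f y)).+1 = pos (f z) \/ (pos (f z)).+1 = pos (f y)) \/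
    [/\ tau (dart (f y)) = dart (f z), dart (f y) != dart (f z),
        pos (f y) = s & pos (f z) = s].
  move/f_adj; have := nocentre; rewrite /= /glued_adj /dart /pos => nc.
  case fy: (f y) => [cy [[i j]|]] /=; last by case: nc; exists y; rewrite fy.
  case fz: (f z) => [cz [[i' j']|]] /=; last by case: nc; exists z; rewrite fz.
  case/orP=> [/and3P[/eqP -> /eqP -> /orP[]/eqP e]|/and4P[/eqP -> /eqP -> /eqP -> ->]].
  - by left; split=> //; left.
  - by left; split=> //; right.
  - by right.
have pos_le u : pos u <= s by rewrite /pos; case: u.2 => [[i j]|] //; rewrite -ltnS.
have pos_dart_inj y z : dart (f y) = dart (f z) -> pos (f y) = pos (f z) -> y = z.
  move=> dyz pyz; apply: f_inj; move: dyz pyz; rewrite /dart /pos.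
  case fy: (f y) => [cy [[i j]|]] /=; last by case: nocentre; exists y; rewrite fy.
  case fz: (f z) => [cz [[i' j']|]] /=; last by case: nocentre; exists z; rewrite fz.
  by case=> -> -> /val_inj ->.
have /card_gt0P[x0 _] := F0; pose D := dart (f x0).
have two y : dart (f y) = D \/ dart (f y) = tau D.
  move: y (cF x0 y); apply: connect_ind => [|y z _ yD yz]; first by left.
  have [[-> _] //|[<- _ _ _]] := edge _ _ yz.
  by case: yD => ->; [right | left; rewrite tauK].
(* Numbering along the path formed by the two arms: 0 to s outwards on [D], then s+1 to 2s+1 back
   inwards on [tau D], so that the joined ends get the consecutive numbers s and s+1. *)
pose num y := if dart (f y) == D then pos (f y) else s.*2.+1 - pos (f y).
have num_lt y : num y < s.*2.+2.
  rewrite /num; have := pos_le (f y); case: ifP => _; lia.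
exists s.*2.+2, (fun y => Some (ord0, Ordinal (num_lt y))); split.
  move=> y z [] /eqP; rewrite /num; have := pos_le (f y); have := pos_le (f z).
  have [yD|yD] := eqVneq (dart (f y)) D; have [zD|zD] := eqVneq (dart (f z)) D => zs ys nyz.
  - by apply: pos_dart_inj; [rewrite yD | apply/eqP].
  - lia.
  - lia.
  - have [/eqP|yD'] := two y; first by rewrite (negPf yD).
    have [/eqP|zD'] := two z; first by rewrite (negPf zD).
    apply: pos_dart_inj; [by rewrite yD' | lia].
move=> y z yz /=; rewrite /num; have ys := pos_le (f y); have zs := pos_le (f z).
have [[-> pyz]|[yz' nyz -> ->]] := edge _ _ yz.
  by case: ifP => _; lia.
have [yD|yD] := eqVneq (dart (f y)) D; have [zD|zD] := eqVneq (dart (f z)) D.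
- by rewrite yD zD eqxx in nyz.
- lia.
- lia.
- have [/eqP|yD'] := two y; first by rewrite (negPf yD).
  by move: zD; rewrite -yz' yD' tauK eqxx.
Qed.

End GluedMegastars.

Section CompleteMinor.

Variables (n s : nat).

Let pt := ('I_n.+1 * 'I_n.+1)%type.
Let o1 : 'I_3 := @Ordinal 3 1 isT.
Let o2 : 'I_3 := @Ordinal 3 2 isT.

(** For fixed [h], the first two arms link the megastars at (h, h') cyclically in h', so each row is
    connected. The third arms join row [h] to row [h'] for all distinct [h] and [h']; on the
    diagonal they stay free. Contracting the rows yields a complete graph on n+1 vertices. *)
Definition wall_dart (d : pt * 'I_3) : pt * 'I_3 :=
  let: (h, h', i) := d in
  if i == ord0 then ((h, ord_pred h'), o1)
  else if i == o1 then ((h, ordS h'), ord0) else ((h', h), i).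

Lemma wall_dartK : involutive wall_dart.
Proof.
move=> [[h h'] [[|[|[|i]]] Hi]] //=; rewrite /wall_dart /=.
- by rewrite ord_predK; congr (_, _); apply: val_inj.
- by rewrite ordSK; congr (_, _); apply: val_inj.
Qed.

Definition wall := glued_megastars s wall_dartK.

Let within h := [rel a b : wall | [&& adj a b, a.1.1 == h & b.1.1 == h]].

Lemma within_sym h : connect_sym (within h).
Proof.
apply: sym_connect_sym => a b; rewrite /within /=; congr andb; last exact: andbC.
by apply: glued_adj_sym; apply: wall_dartK.
Qed.

Lemma within_centre h h' p : connect (within h) ((h, h'), None) ((h, h'), p).
Proof.
case: p => [[i [j Hj]]|]; last exact: connect0.
elim: j Hj => [|j IH] Hj.
  by apply: connect1; rewrite /within /= /glued_adj /= !eqxx.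
apply: connect_trans (IH (ltnW Hj)) (connect1 _).
by rewrite /within /= /glued_adj /= !eqxx.
Qed.

Lemma within_connected h (x y : wall) :
  x.1.1 = h -> y.1.1 = h -> connect (within h) x y.
Proof.
have next h' : connect (within h) ((h, h'), None) ((h, ordS h'), None).
  apply: connect_trans (within_centre h h' (Some (o1, ord_max))) _.
  rewrite within_sym.
  apply: connect_trans (within_centre h (ordS h') (Some (ord0, ord_max))) _.
  rewrite within_sym; apply: connect1.
  by rewrite /within /= /glued_adj /= !eqxx /= andbT andbF; apply/eqP=> -[].
have from0 k (Hk : k < n.+1) :
    connect (within h) ((h, ord0), None) ((h, Ordinal Hk), None).
  elim: k Hk => [|k IH] Hk.
    by rewrite (_ : Ordinal Hk = ord0) ?connect0 //; apply: val_inj.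
  apply: connect_trans (IH (ltnW Hk)) _.
  rewrite (_ : Ordinal Hk = ordS (Ordinal (ltnW Hk))); first exact: next.
  by apply: val_inj; rewrite /= modn_small.
have from h' p : connect (within h) ((h, ord0), None) ((h, h'), p).
  by apply: connect_trans (within_centre _ _ _); case: h' => k Hk; apply: from0.
move: x y => [[h1 x] p] [[h2 y] q] /= -> ->.
by apply: connect_trans (from y q); rewrite within_sym.
Qed.

Lemma wall_cross (h h' : 'I_n.+1) : h != h' ->
  @adj wall ((h, h'), Some (o2, ord_max)) ((h', h), Some (o2, ord_max)).
Proof.
by move=> hh'; rewrite /= /glued_adj /= !eqxx !xpair_eqE (negPf hh') /=.
Qed.

Lemma wall_connected : connected wall.
Proof.
split; first by apply/card_gt0P; exists ((ord0, ord0), None).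
have inh h x y : x.1.1 = h -> y.1.1 = h -> connect (@adj wall) x y.
  move=> xh yh; have := within_connected xh yh; apply: connect_sub => a b.
  by case/and3P=> ab _ _; apply: connect1.
move=> x y; have [xy|xy] := eqVneq x.1.1 y.1.1; first exact: inh.
apply: connect_trans (inh x.1.1 x (x.1.1, y.1.1, Some (o2, ord_max)) _ _) _ => //.
apply: connect_trans (connect1 (wall_cross xy)) _.
exact: (inh y.1.1).
Qed.

Lemma wall_treewidth : n <= treewidth wall.
Proof.
apply: leq_trans (complete_graph_treewidth n) _.
apply: (@treewidth_minor wall (complete_graph n.+1) (fun h => [set x | x.1.1 == h])).
- by move=> h; apply/set0Pn; exists ((h, ord0), None); rewrite inE /=.
- by move=> h h' x; rewrite !inE => /eqP <- /eqP.
- move=> h x y; rewrite !inE => /eqP xh /eqP yh.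
  have := within_connected xh yh; apply: connect_sub => a b ab.
  by apply: connect1; rewrite /= !inE.
- move=> h h' hh'; exists ((h, h'), Some (o2, ord_max)), ((h', h), Some (o2, ord_max)).
  by rewrite !inE /=; split=> //; apply: wall_cross.
Qed.

End CompleteMinor.

(** * Trees, sentences with one variable, and the second bound *)

Lemma one_variable_models (f : form) (G H : sgraph) :
  0 < #|G| -> var_width f <= 1 -> models G f -> models H f.
Proof.
move=> /card_gt0P[g _] f1 fG b.
have eqV x y : x \in all_vars f -> y \in all_vars f -> x = y.
  rewrite -mem_undup -(mem_undup _ y); move: f1; rewrite /var_width.
  by case: (undup _) => [|z [|]] //; rewrite !inE => _ /eqP -> /eqP ->.
(* With a single variable x the only atoms are x = x and the adjacency of x to itself, whose truth
   values are the same everywhere; so the trivial relation is a winning strategy. *)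
suff : sat (fun _ => g) f <-> sat b f by move=> <-; apply: fG.
apply: (@back_and_forth G H (all_vars f) (fun _ _ => True)) => //.
- by move=> a b' _ x y xV yV; rewrite (eqV _ _ xV yV) !adj_irr.
- by move=> a b' x v; exists (b 0).
Qed.

Lemma tree_bound (F : sgraph) : is_tree F -> ~ subtree_of_M3 F -> Wtw_ge F 2.
Proof.
move=> treeF notM3 Phi [_ [k defPhi]]; rewrite ltnNge; apply/negP=> Phi1.
have KF : models (complete_graph (maxn k #|F|).+1) Phi.
  apply/defPhi; first exact: complete_graph_connected.
    by apply: leq_trans (complete_graph_treewidth _); apply: leq_maxl.
  by apply: complete_graph_contains; rewrite leqW // leq_maxr.
have WF : contains (wall k #|F|) F.
  apply/defPhi; [exact: wall_connected | exact: wall_treewidth |].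
  by apply: one_variable_models KF; rewrite ?card_ord.
by apply: notM3; split=> //; apply: small_in_glued_megastars WF; [case: treeF | apply: leqnSn].
Qed.

Theorem theorem7 :
  (forall (F : sgraph) (F0 : {set F}), is_core F0 -> Wtw_ge F #|F0|) /\
  (forall F : sgraph, connected F -> ~ subtree_of_M3 F ->
     Wtw_ge F (treewidth F + 1)).
Proof.
split=> [|F cF notM3]; first exact: core_bound.
have [F0 coreF0] := core_exists F; rewrite addn1 => Phi defPhi.
(* An empty core makes [F] a tree, of treewidth at most 1. Size 1 is impossible as before. For size
   m+2 the bound on the treewidth is applied with k = m+1, which is positive. *)
case ell : #|F0| => [|[|m]].
- have F00 := cards0_eq ell; rewrite F00 in coreF0.
  apply: leq_trans (_ : 2 <= _); first by rewrite ltnS (treewidth_core coreF0) ?cards0.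
  by apply: (tree_bound _ notM3 defPhi); split=> //; apply: empty_core_acyclic.
- have /card_gt0P[x /coreF0.2 dx] : 0 < #|F0| by rewrite ell.
  have : deg_in F0 x <= #|F0| by rewrite /deg_in setIdE subset_leq_card ?subsetIl.
  by rewrite ell leqNgt dx.
- apply: leq_trans (core_bound coreF0 defPhi).
  by rewrite ell ltnS; apply: (treewidth_core coreF0); rewrite ?ell.
Qed.
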